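(* The critical connectivity $\mu_c$ of the homogeneous Kuramoto model satisfies $\mu_c\ge 11/16$. That is, for every $\mu<11/16$ there exists a finite simple graph $G$ with $n$ vertices and minimum degree at least $\mu(n-1)$ that does not synchronize.
   Context: For a finite simple graph $G$ on vertex set $\{1,\dots,n\}$, the homogeneous Kuramoto model is $\dot\theta_v=\sum_{u\sim v}\sin(\theta_u-\theta_v)$ on the torus $(\mathbb{R}/2\pi\mathbb{Z})^n$. Equilibria of the form $(c,\dots,c)$ are called consensus. $G$ synchronizes if the set of initial conditions whose solutions do not converge to a consensus has Lebesgue measure zero. The strong density of $G$ is $\delta(G)/(n-1)$, where $\delta(G)$ is the minimum degree. The critical connectivity $\mu_c$ is the smallest number such that for every $\mu>\mu_c$, every graph of strong density at least $\mu$ synchronizes. *)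

(* Defs.v *)
From HB Require Import structures.
From mathcomp Require Import all_boot all_order all_algebra.
From mathcomp Require Import all_classical all_reals all_analysis.

Set Implicit Arguments.
Unset Strict Implicit.
Unset Printing Implicit Defensive.

Import Order.TTheory GRing.Theory Num.Theory numFieldNormedType.Exports.

Local Open Scope classical_set_scope.
Local Open Scope ring_scope.

Definition simple_graph (n : nat) (e : rel 'I_n) : Prop :=
  symmetric e /\ irreflexive e.

Definition degree (n : nat) (e : rel 'I_n) (v : 'I_n) : nat :=
  #|[set u | e v u]%SET|.

(* For 0 < n the default value n is never attained, every degree being < n. *)
Definition min_degree (n : nat) (e : rel 'I_n) : nat :=
  \big[minn/n]_(v < n) degree e v.

(* For n = 1 this is 0 / 0 = 0. *)
Definition strong_density (R : realType) (n : nat) (e : rel 'I_n) : R :=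
  (min_degree e)%:R / n.-1%:R.

Arguments strong_density R {n} e.

(* A trajectory on the torus (R / 2 pi Z)^n is represented by a lift to R^n;
   the vector field is 2 pi-periodic in each coordinate and globally
   Lipschitz, so each initial condition has exactly one lifted solution,
   defined for all times. *)
Definition kuramoto_solution (R : realType) (n : nat) (e : rel 'I_n)
    (theta : R -> 'rV[R]_n) : Prop :=
  forall (t : R) (v : 'I_n),
    is_derive t 1 (fun s : R => theta s ord0 v)
      (\sum_(u < n | e v u) sin (theta t ord0 u - theta t ord0 v)).

(* Convergence to (c, ..., c) in the quotient metric of (R / 2 pi Z)^n. *)
Definition converges_to_consensus (R : realType) (n : nat)
    (theta : R -> 'rV[R]_n) : Prop :=
  exists c : R, forall eps : R, 0 < eps ->
    \forall t \near +oo, forall v : 'I_n,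
      exists k : int, `|theta t ord0 v - (c + 2 * pi * k%:~R)| < eps.

(* Lebesgue outer measure on R^n, for 0 < n: a set has Lebesgue measure zero
   iff its outer measure is 0. *)
Definition lebesgue_outer (R : realType) (n : nat) (A : set 'rV[R]_n)
    : \bar R :=
  ereal_inf [set s | exists a b : nat -> 'rV[R]_n,
    [/\ forall k i, a k ord0 i <= b k ord0 i,
        A `<=` \bigcup_k
          [set x | forall i, a k ord0 i <= x ord0 i <= b k ord0 i] &
        s = (\sum_(0 <= k <oo)
               (\prod_(i < n) (b k ord0 i - a k ord0 i))%:E)%E]].

(* Initial conditions are taken in the fundamental domain [0, 2 pi)^n, which
   carries the Lebesgue measure of the torus. *)
Definition non_consensus_set (R : realType) (n : nat) (e : rel 'I_n)
    : set 'rV[R]_n :=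
  [set x : 'rV[R]_n | (forall v, 0 <= x ord0 v < 2 * pi) /\
     forall theta : R -> 'rV[R]_n, kuramoto_solution e theta ->
       theta 0 = x -> ~ converges_to_consensus theta].

Arguments non_consensus_set R {n} e.

Definition synchronizes (R : realType) (n : nat) (e : rel 'I_n) : Prop :=
  lebesgue_outer (non_consensus_set R e) = 0%E.

Arguments synchronizes R {n} e.

Definition sync_thresholds (R : realType) : set R :=
  [set m | forall mu : R, m < mu ->
     forall (n : nat) (e : rel 'I_n), (0 < n)%N -> simple_graph e ->
       mu <= strong_density R e -> synchronizes R e].

Arguments sync_thresholds R : clear implicits.

Definition critical_connectivity (R : realType) : R :=
  inf (sync_thresholds R).

Arguments critical_connectivity R : clear implicits.

(* The infimum is attained, so it is the smallest threshold. *)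
Lemma critical_connectivity_smallest (R : realType) :
  has_inf (sync_thresholds R) ->
  sync_thresholds R (critical_connectivity R) /\
  lbound (sync_thresholds R) (critical_connectivity R).
Proof.
move=> hS; split; last first.
  by move=> m Sm; apply: ge_inf => //; case: hS.
move=> mu ltmu; have [m Sm ltm] := inf_lt (proj1 hS) ltmu.
exact: Sm.
Qed.

(* Main.v *)
(* Arrange 8 blocks of m = 2r + 1 oscillators as pairs (c, -), (c, +), c in
   Z / 4, the block (c, s) sitting at angle c pi/2 + s phi.  Oscillators of the
   same pair are joined, and so are those of consecutive pairs, except that the
   links between (c, -) and (c + 1, +), which are longer than a quarter turn,
   are thinned out to an r-regular bipartite graph.  Such links pull the pairs
   apart, and the state is an equilibrium exactly when tan phi = 1 - r / m.
   As r / m < 1 / 2, the Laplacian weighted by the cosines of the angle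
   differences is positive definite modulo rotations, so the energy has a
   strict minimum modulo rotations there and the nearby trajectories of the
   gradient flow stay in a tube that contains no consensus.  All degrees equal
   11 r + 4, out of 16 r + 8 vertices, whence the density 11 / 16 as r grows. *)
Require Import Defs.
From mathcomp Require Import all_boot all_order all_algebra.
From mathcomp Require Import all_classical all_reals all_analysis.
From mathcomp Require Import measurable_realfun zify ring lra.

Set Implicit Arguments.
Unset Strict Implicit.
Unset Printing Implicit Defensive.

Import Order.TTheory GRing.Theory Num.Theory numFieldNormedType.Exports.

Local Open Scope ring_scope.

(** * Outer measure of boxes *)

(** Induction on the dimension using one-dimensional Lebesgue measure: fix the first coordinate [y],
    apply the induction hypothesis to the slices, integrate over [y] and swap sum and integral. The
    weights [w] carry the induction, since slicing multiplies the weight of box [k] by the indicator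
    that its first side contains [y]. *)
Lemma box_volume_le_cover (R : realType) (n : nat) (w : nat -> R)
    (a b : nat -> 'I_n -> R) (c d : 'I_n -> R) :
  (forall k, 0 <= w k) -> (forall k i, a k i <= b k i) ->
  (forall i, c i <= d i) ->
  (forall x : 'I_n -> R, (forall i, c i <= x i <= d i) ->
     (1 <= \sum_(0 <= k <oo)
        (w k * [forall i, a k i <= x i <= b k i]%:R)%:E)%E) ->
  ((\prod_(i < n) (d i - c i))%:E <=
     \sum_(0 <= k <oo) (w k * \prod_(i < n) (b k i - a k i))%:E)%E.
Proof.
elim: n w a b c d => [|n IHn] w a b c d w0 ab cd cover.
  rewrite big_ord0 (le_trans (cover d _))//; first by case.
  apply: lee_nneseries => [k _ _|k _]; rewrite lee_fin.
    by rewrite mulr_ge0.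
  by rewrite big_ord0; case: [forall i, _]; rewrite ?mulr1// mulr0.
set V := \prod_(i < n) (d (lift ord0 i) - c (lift ord0 i)).
pose v k := \prod_(i < n) (b k (lift ord0 i) - a k (lift ord0 i)).
have v0 k : 0 <= v k by apply: prodr_ge0 => i _; rewrite subr_ge0.
have V0 : 0 <= V by apply: prodr_ge0 => i _; rewrite subr_ge0.
(* [f k y] is the weighted volume of the slice of box [k] at height [y]. *)
pose f k (y : R) := (w k * v k * \1_`[a k ord0, b k ord0]%classic y)%:E.
have f0 k y : (0 <= f k y)%E by rewrite lee_fin !mulr_ge0// indicE ler0n.
have mf k : measurable_fun [set: R] (f k).
  apply/measurable_EFinP; apply: measurable_funM => //.
have slice y : `[c ord0, d ord0]%classic y ->
    (V%:E <= \sum_(0 <= k <oo) f k y)%E.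
  move=> /= ycd.
  have := IHn (fun k => w k * \1_`[a k ord0, b k ord0]%classic y)
    (fun k i => a k (lift ord0 i)) (fun k i => b k (lift ord0 i))
    (fun i => c (lift ord0 i)) (fun i => d (lift ord0 i)).
  rewrite -/V => H; apply: le_trans (H _ _ _ _) _ => //.
  - by move=> k; rewrite mulr_ge0// indicE ler0n.
  - move=> x xcd.
    pose z i := oapp x y (unlift ord0 i).
    have z0 : z ord0 = y by rewrite /z unlift_none.
    have zS i : z (lift ord0 i) = x i by rewrite /z liftK.
    have /cover/le_trans : forall i, c i <= z i <= d i.
      by move=> i; case: (unliftP ord0 i) => [j ->|->]; rewrite ?zS ?z0.
    apply; apply: lee_nneseries => [k _ _|k _]; rewrite lee_fin.
      by rewrite mulr_ge0.
    rewrite -mulrA ler_wpM2l// indicE -natrM ler_nat mulnb.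
    case: forallP => //= h; rewrite lt0b; apply/andP; split.
      by apply/mem_set; have := h ord0; rewrite z0 /= in_itv.
    by apply/forallP => i; have := h (lift ord0 i); rewrite zS.
  - apply: lee_nneseries => [k _ _|k _]; rewrite lee_fin.
      by rewrite mulr_ge0 ?v0 ?mulr_ge0.
    by rewrite -/(v k) mulrAC.
pose mu := @lebesgue_measure R.
have mI (p q : R) : p <= q -> mu `[p, q]%classic = (q - p)%:E.
  rewrite /mu lebesgue_measure_itv/= lte_fin.
  by case: ltgtP => [||->] //; rewrite subrr.
have mcd : measurable (`[c ord0, d ord0]%classic : set R) by [].
have le1 : ((V * (d ord0 - c ord0))%:E <=
    \int[mu]_(y in `[c ord0, d ord0]%classic) \sum_(0 <= k <oo) f k y)%E.
  rewrite EFinM -mI// -(integral_cst mu)//.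
  apply: ge0_le_integral => //.
  apply: ge0_emeasurable_sum => [k y _ _|k _]; first exact: f0.
  exact: (measurable_funTS (mf k)).
rewrite big_ord_recl mulrC; apply: (le_trans le1).
rewrite integral_nneseries//; last by move=> k; exact: (measurable_funTS (mf k)).
apply: lee_nneseries => [k _ _|k _]; first exact: integral_ge0.
rewrite /f; under eq_integral do rewrite EFinM.
rewrite ge0_integralZl//; last first.
  by rewrite lee_fin mulr_ge0.
  by apply/measurable_EFinP; exact: measurable_indic.
rewrite integral_indic// big_ord_recl -/(v k) (mulrC (_ - _)) mulrA [X in (_ <= X)%E]EFinM.
apply: lee_pmul => //; first by rewrite lee_fin mulr_ge0.
rewrite -mI//; apply: le_measure; rewrite ?inE//.
exact: measurableI.
Qed.

Lemma lebesgue_outer_gt0 (R : realType) (n : nat) (A : set 'rV[R]_n)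
    (c d : 'I_n -> R) :
  (forall i, c i < d i) ->
  (forall x : 'rV[R]_n, (forall i, c i <= x ord0 i <= d i) -> A x) ->
  (0 < lebesgue_outer A)%E.
Proof.
move=> cd boxA; apply: (@lt_le_trans _ _ (\prod_(i < n) (d i - c i))%:E).
  by rewrite lte_fin prodr_gt0// => i _; rewrite subr_gt0.
apply: le_ereal_inf_tmp => _ [a [b [ab Acov ->]]].
have := @box_volume_le_cover R n (fun=> 1) (fun k i => a k ord0 i)
  (fun k i => b k ord0 i) c d.
under eq_eseriesr do rewrite mul1r.
apply => // [i|x xcd]; first exact: ltW.
have [|k _ kx] := Acov (\row_i x i).
  by apply: boxA => i; rewrite mxE.
apply: le_trans (nneseries_lim_ge k.+1 _) => /=; last first.
  by move=> j _ _; rewrite lee_fin mul1r.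
rewrite big_nat_recr//= mul1r.
have -> : [forall i, a k ord0 i <= x i <= b k ord0 i].
  by apply/forallP => i; have := kx i; rewrite mxE.
by rewrite leeDr// sume_ge0// => j _; rewrite lee_fin mul1r.
Qed.

(** * Energy and trapping near a stable equilibrium *)

Lemma norm_sin_le (R : realType) (x : R) : `|sin x| <= `|x|.
Proof.
wlog x0 : x / 0 <= x.
  by case: (leP 0 x) => [x0 ->//|x0 /(_ (- x))]; rewrite sinN !normrN; apply; lra.
have [c _] := @MVT_segment R sin cos 0 x x0 (fun y _ => is_derive_sin y)
  (continuous_subspaceT (@continuous_sin R)).
rewrite sin0 !subr0 => ->; rewrite normrM ler_piMl//.
by rewrite ler_norml cos_geN1 cos_le1.
Qed.

Lemma cos_ge_quadratic (R : realType) (x : R) : 1 - x ^+ 2 / 2 <= cos x.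
Proof.
have -> : cos x = 1 - 2 * sin (x / 2) ^+ 2.
  rewrite {1}(_ : x = x / 2 + x / 2); last by lra.
  rewrite cosD; have := cos2Dsin2 (x / 2); nra.
have := norm_sin_le (x / 2); rewrite -ler_sqr ?nnegrE//.
rewrite !real_normK ?num_real//; nra.
Qed.

(** Mean value theorem with the quadratic bound on [1 - cos]. Here and for the cosine, the constant
    1 in place of the Taylor coefficient is sharp enough for [energy_growth]. *)
Lemma norm_sin_sub_le (R : realType) (x : R) : `|sin x - x| <= `|x| ^+ 3.
Proof.
wlog x0 : x / 0 <= x.
  case: (leP 0 x) => [x0 ->//|x0 /(_ (- x))]; rewrite sinN -opprD !normrN; apply; lra.
have [|c] := @MVT_segment R (sin \- id) (fun y => cos y - 1) 0 x x0.
  by apply: continuous_subspaceT => y; apply: cvgB; [exact: continuous_sin|exact: cvg_id].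
rewrite in_itv/= => /andP[c0 cx]; rewrite /= sin0 !subr0 => ->.
rewrite normrM exprSr ler_wpM2r// (ger0_norm x0) ler_norml.
have := cos_le1 c; have := cos_ge_quadratic c; nra.
Qed.

Lemma norm_cos_sub_le (R : realType) (x : R) :
  `|cos x - 1 + x ^+ 2 / 2| <= `|x| ^+ 4.
Proof.
wlog x0 : x / 0 <= x.
  by case: (leP 0 x) => [x0 ->//|x0 /(_ (- x))]; rewrite cosN sqrrN !normrN; apply; lra.
have [| |c] := @MVT_segment R (fun y => cos y + y ^+ 2 / 2) (fun y => - sin y + y) 0 x x0.
- move=> y _; apply: is_derive_eq.
  by rewrite !scaler0 add0r /GRing.scale/= mulr1; lra.
- apply: continuous_subspaceT => y; apply: cvgD; first exact: continuous_cos.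
  by apply: cvgMl; apply: exprn_continuous.
rewrite in_itv/= => /andP[c0 cx]; rewrite /= cos0 expr0n /= mul0r addr0 subr0.
rewrite addrAC => ->.
rewrite normrM exprSr ler_wpM2r// [- _ + _]addrC distrC.
by rewrite (le_trans (norm_sin_sub_le c))// lerXn2r ?nnegrE// !ger0_norm.
Qed.

Lemma is_derive_bigsum (R : realType) (I : Type) (r : seq I) (P : pred I)
    (h : I -> R -> R) (dh : I -> R) (t : R) :
  (forall i, P i -> is_derive t 1 (h i) (dh i)) ->
  is_derive t 1 (fun s => \sum_(i <- r | P i) h i s) (\sum_(i <- r | P i) dh i).
Proof.
move=> D; elim: r => [|i r IHr].
  under eq_fun do rewrite big_nil.
  by rewrite big_nil; exact: is_derive_cst.
under eq_fun do rewrite big_cons.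
rewrite big_cons; case: ifP => // Pi.
by apply: is_deriveD => //; exact: D.
Qed.

Section GradientFlow.
Context (R : realType) (n : nat) (e : rel 'I_n).

(** Ordered pairs count each edge twice, so for symmetric [e] the Kuramoto field is minus half the
    gradient of [energy]. *)
Definition energy (x : 'I_n -> R) : R :=
  - \sum_u \sum_(v | e u v) cos (x u - x v).

Definition equilibrium (x : 'I_n -> R) : Prop :=
  forall v, \sum_(u | e v u) sin (x u - x v) = 0.

(** A squared seminorm that vanishes exactly on constant vectors, hence measures displacements
    modulo rotations. *)
Definition spread (x : 'I_n -> R) : R := \sum_u \sum_v (x u - x v) ^+ 2.

Hypothesis e_sym : symmetric e.

(** Summation by parts: the two orientations of an edge contribute equally. With [f] a sine of
    differences it yields both the dissipation of energy and the vanishing of its first-order term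
    at an equilibrium. *)
Lemma sum_edges_antisym (f : 'I_n -> 'I_n -> R) (x : 'I_n -> R) :
  (forall u v, f u v = - f v u) ->
  \sum_u \sum_(v | e u v) f u v * (x u - x v) =
  - 2 * \sum_u x u * \sum_(v | e u v) f v u.
Proof.
move=> fN.
have E : \sum_u \sum_(v | e u v) f u v * x u = - \sum_u x u * \sum_(v | e u v) f v u.
  rewrite -sumrN; apply: eq_bigr => u _; rewrite mulr_sumr -sumrN.
  by apply: eq_bigr => v _; rewrite fN mulNr mulrC.
have E' : \sum_u \sum_(v | e u v) f u v * x v = \sum_u x u * \sum_(v | e u v) f v u.
  rewrite [LHS](exchange_big_dep xpredT)//=; apply: eq_bigr => u _.
  by rewrite mulr_sumr; apply: eq_big => [v|v _]; rewrite 1?e_sym// mulrC.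
under eq_bigr do under eq_bigr do rewrite mulrBr.
under eq_bigr do rewrite sumrB.
by rewrite sumrB E E'; lra.
Qed.

(** Along the flow the energy has derivative [-2] times the sum of the squared velocities. *)
Lemma energy_nonincreasing (theta : R -> 'rV[R]_n) (t : R) :
  kuramoto_solution e theta -> 0 <= t ->
  energy (theta t ord0) <= energy (theta 0 ord0).
Proof.
move=> sol t0.
pose f (s : R) v := \sum_(u < n | e v u) sin (theta s ord0 u - theta s ord0 v).
have D (s : R) : is_derive s 1 (fun s : R => energy (theta s ord0)) (- 2 * \sum_u f s u ^+ 2).
  have -> : - 2 * \sum_u f s u ^+ 2 = - \sum_u \sum_(v | e u v)
      (f s u - f s v) * (- sin (theta s ord0 u - theta s ord0 v)).
    under [in RHS]eq_bigr do under eq_bigr do rewrite mulrC.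
    rewrite (@sum_edges_antisym (fun u v => - sin (theta s ord0 u - theta s ord0 v))).
      rewrite -mulrN -sumrN; congr (_ * _); apply: eq_bigr => u _.
      rewrite expr2 -mulrN -sumrN; congr (_ * _); apply: eq_bigr => v _.
      by rewrite opprK.
    by move=> u v; rewrite -[in RHS]sinN opprB.
  apply: is_deriveN; apply: is_derive_bigsum => u _; apply: is_derive_bigsum => v _.
  rewrite mulrC.
  apply: (@is_derive1_comp R cos (fun s : R => theta s ord0 u - theta s ord0 v)).
  by apply: is_deriveB; apply: sol.
have C : continuous (fun s : R^o => energy (theta s ord0)).
  move=> s; apply: differentiable_continuous; apply/derivable1_diffP.
  by have [] := D s.
have [c _] := MVT_segment t0 (fun s _ => D s) (continuous_subspaceT C).
move=> /eqP; rewrite subr_eq => /eqP ->; rewrite gerDr subr0.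
by rewrite mulr_le0_ge0// mulr_le0_ge0// sumr_ge0// => u _; exact: sqr_ge0.
Qed.

(** Second-order Taylor expansion. The linear term vanishes at an equilibrium, the quadratic term is
    at least [kappa / 2 * spread x], and the sine and cosine remainders cost at most [rho * z ^+ 2]
    each per edge, together at most [kappa / 4 * spread x]. *)
Lemma energy_growth (theta x : 'I_n -> R) (kappa rho : R) :
  0 <= kappa ->
  equilibrium theta ->
  kappa * spread x <=
    \sum_u \sum_(v | e u v) cos (theta u - theta v) * (x u - x v) ^+ 2 ->
  rho <= 1 -> rho <= kappa / 8 -> (forall u v, `|x u - x v| <= rho) ->
  kappa / 4 * spread x <= energy (fun v => theta v + x v) - energy theta.
Proof.
move=> kappa0 eq_theta stab rho1 rhok xrho.
have lin0 : \sum_u \sum_(v | e u v) sin (theta u - theta v) * (x u - x v) = 0.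
  rewrite sum_edges_antisym => [|u v]; last by rewrite -sinN opprB.
  by rewrite big1 ?mulr0// => u _; rewrite eq_theta mulr0.
have edge u v : cos (theta u - theta v) * (x u - x v) ^+ 2 / 2 +
    sin (theta u - theta v) * (x u - x v) - 2 * rho * (x u - x v) ^+ 2 <=
    cos (theta u - theta v) - cos (theta u + x u - (theta v + x v)).
  set a := theta u - theta v; set z := x u - x v.
  have -> : theta u + x u - (theta v + x v) = a + z by rewrite /a /z; lra.
  rewrite cosD.
  have zr : `|z| <= rho by exact: xrho.
  have z2 : z ^+ 2 = `|z| ^+ 2 by rewrite real_normK ?num_real.
  have S3 : `|sin a * (sin z - z)| <= rho * z ^+ 2.
    rewrite normrM [in leRHS]z2; apply: le_trans (ler_pM _ _ (_ : _ <= 1) (norm_sin_sub_le z)) _ => //.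
      by rewrite ler_norml sin_geN1 sin_le1.
    rewrite mul1r.
    by rewrite exprS ler_wpM2r// exprn_ge0.
  have C4 : `|cos a * (cos z - 1 + z ^+ 2 / 2)| <= rho * z ^+ 2.
    rewrite normrM [in leRHS]z2; apply: le_trans (ler_pM _ _ (_ : _ <= 1) (norm_cos_sub_le z)) _ => //.
      by rewrite ler_norml cos_geN1 cos_le1.
    rewrite mul1r.
    rewrite (exprD _ 2 2) ler_wpM2r ?exprn_ge0// (le_trans _ zr)//.
    by rewrite expr2 ler_piMl// (le_trans zr).
  move: S3 C4; rewrite !ler_norml => /andP[S3 _] /andP[_ C4].
  move: (cos a) (sin a) (cos z) (sin z) S3 C4 => ca sa cz sz; nra.
have edges_le_spread : \sum_u \sum_(v | e u v) (x u - x v) ^+ 2 <= spread x.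
  apply: ler_sum => u _; rewrite [leRHS](bigID (e u))/= lerDl.
  by apply: sumr_ge0 => v _; exact: sqr_ge0.
have -> : energy (fun v => theta v + x v) - energy theta =
    \sum_u \sum_(v | e u v) (cos (theta u - theta v) -
       cos (theta u + x u - (theta v + x v))).
  rewrite /energy opprK addrC -sumrB; apply: eq_bigr => u _.
  by rewrite -sumrB.
apply: le_trans (ler_sum _ (fun u _ => ler_sum _ (fun v _ => edge u v))).
under [leRHS]eq_bigr do rewrite sumrB big_split/= -mulr_suml -mulr_sumr.
rewrite sumrB big_split/= lin0 addr0 -mulr_suml -mulr_sumr.
have S0 : 0 <= spread x.
  by apply: sumr_ge0 => u _; apply: sumr_ge0 => v _; exact: sqr_ge0.
have E0 : 0 <= \sum_u \sum_(v | e u v) (x u - x v) ^+ 2.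
  by apply: sumr_ge0 => u _; apply: sumr_ge0 => v _; exact: sqr_ge0.
move: edges_le_spread stab S0 E0.
move: (spread x) (\sum_u \sum_(v | e u v) (x u - x v) ^+ 2).
move: (\sum_u \sum_(v | e u v) _ * _) => Q S E ES kQ S0 E0.
have : 2 * rho * E <= kappa / 4 * S by nra.
lra.
Qed.

End GradientFlow.

(** Near a consensus [a - b] would be within 1/4 of a multiple of a full turn, while it is within
    1/4 of [pi / 2]; as [pi >= 2], these ranges are disjoint. *)
Lemma no_consensus_at_quarter_turn (R : realType) (a b c : R) (k l : int) :
  `|a - b - pi / 2| < 1 / 4 -> `|a - (c + 2 * pi * k%:~R)| < 1 / 8 ->
  `|b - (c + 2 * pi * l%:~R)| < 1 / 8 -> False.
Proof.
have pi2 := pi_ge2 R.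
rewrite !ltr_norml => /andP[g1 g2] /andP[k1 k2] /andP[l1 l2].
have [kl|kl] : k - l <= 0 \/ 1 <= k - l by lia.
  have : pi * (k%:~R - l%:~R) <= 0 :> R.
    by rewrite mulr_ge0_le0 ?pi_ge0// -rmorphB lerz0.
  lra.
have : pi <= pi * (k%:~R - l%:~R) :> R.
  by rewrite ler_peMr ?pi_ge0// -rmorphB ler1z.
lra.
Qed.

Section StableEquilibrium.
Context (R : realType) (n : nat) (e : rel 'I_n).
Hypothesis e_sym : symmetric e.
Variables (theta0 : 'I_n -> R) (kappa : R).
Hypothesis eq_theta0 : equilibrium e theta0.
Hypothesis kappa0 : 0 < kappa.
Hypothesis stable : forall x : 'I_n -> R,
  kappa * spread x <=
  \sum_u \sum_(v | e u v) cos (theta0 u - theta0 v) * (x u - x v) ^+ 2.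

Lemma sum_pairs_le (P : rel 'I_n) (f : 'I_n -> 'I_n -> R) (c : R) :
  0 <= c -> (forall u v, f u v <= c) ->
  \sum_u \sum_(v | P u v) f u v <= n%:R ^+ 2 * c.
Proof.
move=> c0 fc; have row u : \sum_(v | P u v) f u v <= n%:R * c.
  apply: le_trans (ler_sum _ (fun v _ => fc u v)) _.
  apply: (@le_trans _ _ (\sum_(v < n) c)).
    by rewrite [leRHS](bigID (P u))/= lerDl sumr_ge0.
  by rewrite sumr_const card_ord mulr_natl.
apply: le_trans (ler_sum _ (fun u _ => row u)) _.
by rewrite sumr_const card_ord -[leLHS]mulr_natl mulrA -expr2.
Qed.

Lemma sqr_sub_le_spread (x : 'I_n -> R) u v : (x u - x v) ^+ 2 <= spread x.
Proof.
rewrite /spread (bigD1 u)//= (bigD1 v)//= -addrA lerDl addr_ge0//.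
  by apply: sumr_ge0 => *; exact: sqr_ge0.
by apply: sumr_ge0 => *; apply: sumr_ge0 => *; exact: sqr_ge0.
Qed.

(* A trajectory leaving the tube [spread < rho ^ 2] around the line of
   equilibria would have to climb the energy barrier [kappa / 4 * rho ^ 2] on
   its boundary. *)
Lemma spread_stays_small (theta : R -> 'rV[R]_n) (rho : R) :
  kuramoto_solution e theta -> 0 < rho -> rho <= 1 -> rho <= kappa / 8 ->
  spread (fun v => theta 0 ord0 v - theta0 v) < rho ^+ 2 ->
  energy e (theta 0 ord0) - energy e theta0 < kappa / 4 * rho ^+ 2 ->
  forall t, 0 <= t -> spread (fun v => theta t ord0 v - theta0 v) < rho ^+ 2.
Proof.
move=> sol rho0 rho1 rhok start_in start_low t t0; rewrite ltNge; apply/negP => out.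
pose q s := spread (fun v => theta s ord0 v - theta0 v).
have q_cont : continuous (q : R^o -> R).
  have c v : continuous ((fun s : R => theta s ord0 v - theta0 v) : R^o -> R).
    move=> s; apply: cvgB; last exact: cvg_cst.
    apply: differentiable_continuous; apply/derivable1_diffP.
    by have [] := sol s v.
  move=> s; apply: (cvg_big add_continuous) => u _; apply: (cvg_big add_continuous) => v _.
  apply: (@continuous_comp _ _ _ (fun s : R^o => _) (fun y : R => y ^+ 2)).
    by apply: cvgB; apply: c.
  exact: exprn_continuous.
have [|s] := @IVT R q 0 t (rho ^+ 2) t0 (continuous_subspaceT q_cont).
  by rewrite ge_min le_max (ltW start_in) out orbT.
rewrite in_itv/= => /andP[s0 _] qs.
have := @energy_growth R n e e_sym theta0 (fun v => theta s ord0 v - theta0 v)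
  kappa rho (ltW kappa0) eq_theta0 (stable _) rho1 rhok.
rewrite -/(q s) qs => H.
have {H} : kappa / 4 * rho ^+ 2 <=
    energy e (fun v => theta0 v + (theta s ord0 v - theta0 v)) - energy e theta0.
  apply: H => u v; rewrite -ler_sqr ?nnegrE ?(ltW rho0)//.
  by rewrite real_normK ?num_real// -qs; exact: (sqr_sub_le_spread _ u v).
under [X in energy e X]eq_fun do rewrite addrC subrK.
have := energy_nonincreasing e_sym sol s0; lra.
Qed.

(** A whole box around [theta0] starts inside the tube and below the energy barrier. Its
    trajectories remain in the tube, where [u0] and [v0] stay about a quarter turn apart, so the
    non-consensus set contains a box of positive volume. *)
Lemma stable_not_synchronizes (u0 v0 : 'I_n) :
  (forall v, 0 < theta0 v < 2 * pi) -> theta0 u0 - theta0 v0 = pi / 2 ->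
  ~ synchronizes R e.
Proof.
move=> theta0_in gap.
(* 1/4 is the tolerance of [no_consensus_at_quarter_turn], [kappa / 8] the range of
   [energy_growth]. *)
pose rho : R := Num.min (1 / 4) (kappa / 8).
have rho0 : 0 < rho by rewrite /rho lt_min !divr_gt0.
have rho4 : rho <= 1 / 4 by rewrite ge_min lexx.
have rhok : rho <= kappa / 8 by rewrite ge_min lexx orbT.
have N0 : 0 <= n%:R ^+ 2 :> R by rewrite sqr_ge0.
(* In a box of half-width [h], each of the [n ^ 2] ordered pairs adds at most [4 * h] to the spread
   and to the energy excess; [h < b] keeps both totals below their thresholds. The [+ 1] makes the
   denominator visibly positive. *)
pose b : R := Num.min (rho ^+ 2) (kappa / 4 * rho ^+ 2) / (4 * n%:R ^+ 2 + 1).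
have b0 : 0 < b.
  by rewrite divr_gt0 ?lt_min ?exprn_gt0 ?mulr_gt0 ?exprn_gt0// ?divr_gt0//; lra.
have [h [h0 h4 hb hlo hhi]] : exists h : R, [/\ 0 < h, h < 1 / 4, h < b,
    forall v, h < theta0 v & forall v, h < 2 * pi - theta0 v].
  near (at_right (0 : R)) => h; exists h; split; near: h.
  - exact: nbhs_right_gt.
  - by apply: nbhs_right_lt; lra.
  - exact: nbhs_right_lt.
  - apply: filter_forall => v; apply: nbhs_right_lt.
    by have /andP[] := theta0_in v.
  - apply: filter_forall => v; apply: nbhs_right_lt.
    by rewrite subr_gt0; have /andP[] := theta0_in v.
rewrite /synchronizes => out0.
suff : (0 < lebesgue_outer (non_consensus_set R e))%E by rewrite out0 ltxx.
apply: (@lebesgue_outer_gt0 R n _ (fun v => theta0 v - h) (fun v => theta0 v + h)).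
  by move=> v; lra.
move=> x xbox; split.
  move=> v; have := xbox v; have := hlo v; have := hhi v.
  by move=> *; apply/andP; split; lra.
move=> theta sol theta_0 [c cons].
have dev u v : `|(x ord0 u - theta0 u) - (x ord0 v - theta0 v)| <= 2 * h.
  by rewrite ler_norml; have := xbox u; have := xbox v; lra.
have hN : 4 * n%:R ^+ 2 * h < Num.min (rho ^+ 2) (kappa / 4 * rho ^+ 2).
  move: hb; rewrite /b ltr_pdivlMr; last by lra.
  by apply: le_lt_trans; nra.
have stay : forall t, 0 <= t ->
    spread (fun v => theta t ord0 v - theta0 v) < rho ^+ 2.
  apply: spread_stays_small => //; rewrite ?theta_0; first by lra.
  - move: hN; rewrite lt_min => /andP[hN _]; apply: le_lt_trans hN.
    apply: (le_trans (sum_pairs_le _ (c := 4 * h) _ _)); [by lra| |by lra].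
    move=> u v; have := dev u v; rewrite ler_norml => /andP[]; nra.
  - move: hN; rewrite lt_min => /andP[_ hN]; apply: le_lt_trans hN.
    rewrite /energy opprK addrC -sumrB.
    under eq_bigr do rewrite -sumrB.
    apply: (le_trans (sum_pairs_le _ (c := 4 * h) _ _)); [by lra| |by lra].
    (* The difference is [cos a * (1 - cos z) + sin a * sin z], and each summand is at most
       [2 * h]. *)
    move=> u v; set a := theta0 u - _.
    have -> : x ord0 u - x ord0 v =
        a + ((x ord0 u - theta0 u) - (x ord0 v - theta0 v)) by rewrite /a; lra.
    move: (dev u v); set z := (_ - _ - _) => zh.
    rewrite cosD.
    have := norm_sin_le z; have := cos_ge_quadratic z; have := cos_le1 z.
    have := cos_geN1 a; have := cos_le1 a; have := sin_geN1 a; have := sin_le1 a.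
    move: zh; rewrite ler_norml => /andP[z1 z2] s1 s2 c1 c2 cz1 cz2.
    move=> sz; have {sz} : `|sin z| <= 2 * h.
      by apply: le_trans sz _; rewrite ler_norml z1.
    rewrite ler_norml => /andP[sz1 sz2].
    have Sb : sin a * sin z <= 2 * h by nra.
    have Cb : cos a * (1 - cos z) <= 2 * h by nra.
    lra.
have [t [t0 close]] : exists t : R, 0 <= t /\
    forall v : 'I_n, exists k : int, `|theta t ord0 v - (c + 2 * pi * k%:~R)| < 1 / 8.
  near (pinfty_nbhs R) => t; exists t; split; near: t; first exact: nbhs_pinfty_ge.
  by apply: cons; lra.
have near_gap : `|(theta t ord0 u0 - theta0 u0) - (theta t ord0 v0 - theta0 v0)| < rho.
  rewrite -ltr_sqr ?nnegrE ?(ltW rho0)// real_normK ?num_real//.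
  exact: le_lt_trans (sqr_sub_le_spread _ u0 v0) (stay t t0).
have [k ku] := close u0; have [l lv] := close v0.
apply: (no_consensus_at_quarter_turn _ ku lv).
rewrite -gap -[X in `|X|](_ : theta t ord0 u0 - theta0 u0 -
  (theta t ord0 v0 - theta0 v0) = _); first exact: lt_le_trans near_gap rho4.
by ring.
Unshelve. all: end_near.
Qed.

End StableEquilibrium.

(** * Quadratic forms on blocks *)

Section Blocks.
Context (R : realType) (m : nat).

Definition mean (f : 'I_m.+1 -> R) : R := (\sum_i f i) / m.+1%:R.

Definition dispersion (f : 'I_m.+1 -> R) : R := \sum_i (f i - mean f) ^+ 2.

Lemma sum_sub_mean (f : 'I_m.+1 -> R) : \sum_i (f i - mean f) = 0.
Proof.
by rewrite sumrB sumr_const card_ord -mulr_natr divfK ?pnatr_eq0// subrr.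
Qed.

Lemma dispersion_ge0 (f : 'I_m.+1 -> R) : 0 <= dispersion f.
Proof. by apply: sumr_ge0 => i _; exact: sqr_ge0. Qed.

(* In a biregular bipartite graph the deviations from the two means do not
   interact with the difference of the means. *)
Lemma biregular_sum_sqr (A : rel 'I_m.+1) (d : nat) (f g : 'I_m.+1 -> R) :
  (forall i, #|[pred j | A i j]| = d) -> (forall j, #|[pred i | A i j]| = d) ->
  \sum_i \sum_(j | A i j) (f i - g j) ^+ 2 =
  d%:R * (dispersion f + dispersion g) + (d * m.+1)%:R * (mean f - mean g) ^+ 2
  - 2 * \sum_i \sum_(j | A i j) (f i - mean f) * (g j - mean g).
Proof.
move=> Al Ar; pose u i := f i - mean f; pose v j := g j - mean g.
pose D := mean f - mean g.
have row (h : 'I_m.+1 -> R) : \sum_i \sum_(j | A i j) h i = d%:R * \sum_i h i.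
  rewrite mulr_sumr; apply: eq_bigr => i _.
  by rewrite sumr_const Al mulr_natl.
have col (h : 'I_m.+1 -> R) : \sum_i \sum_(j | A i j) h j = d%:R * \sum_j h j.
  rewrite (exchange_big_dep xpredT)//= mulr_sumr; apply: eq_bigr => j _.
  by rewrite sumr_const Ar mulr_natl.
have expand i j : (f i - g j) ^+ 2 =
    u i ^+ 2 + v j ^+ 2 + D ^+ 2 + 2 * D * u i - 2 * D * v j - 2 * (u i * v j).
  by rewrite /u /v /D; ring.
under eq_bigr do under eq_bigr do rewrite expand.
under eq_bigr do rewrite !sumrB !big_split/=.
rewrite !sumrB !big_split/= !row !col -!mulr_sumr.
under eq_bigr do rewrite -mulr_sumr.
rewrite -mulr_sumr !sum_sub_mean sumr_const card_ord -mulr_natr natrM.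
rewrite /dispersion -[D *+ _]mulr_natr -/D.
by rewrite -/(\sum_i \sum_(j | A i j) u i * v j); ring.
Qed.

(** The cross term is absorbed by [-2uv <= u^2 + v^2] on each link, which doubles the coefficient of
    the dispersions. An upper bound is the useful direction because the thinned links enter with
    negative weight. *)
Lemma biregular_sum_sqr_le (A : rel 'I_m.+1) (d : nat) (f g : 'I_m.+1 -> R) :
  (forall i, #|[pred j | A i j]| = d) -> (forall j, #|[pred i | A i j]| = d) ->
  \sum_i \sum_(j | A i j) (f i - g j) ^+ 2 <=
  2 * d%:R * (dispersion f + dispersion g)
  + (d * m.+1)%:R * (mean f - mean g) ^+ 2.
Proof.
move=> Al Ar; rewrite (biregular_sum_sqr _ _ Al Ar).
pose u i := f i - mean f; pose v j := g j - mean g.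
suff : - 2 * \sum_i \sum_(j | A i j) u i * v j <=
    d%:R * (dispersion f + dispersion g) by lra.
have -> : d%:R * (dispersion f + dispersion g) =
    \sum_i \sum_(j | A i j) (u i ^+ 2 + v j ^+ 2).
  under eq_bigr do rewrite big_split/= sumr_const Al.
  rewrite big_split/= mulrDr; congr (_ + _).
    by rewrite /dispersion mulr_sumr; apply: eq_bigr => i _; rewrite mulr_natl.
  rewrite (exchange_big_dep xpredT)//= mulr_sumr; apply: eq_bigr => j _.
  by rewrite sumr_const Ar mulr_natl.
rewrite mulr_sumr; apply: ler_sum => i _; rewrite mulr_sumr; apply: ler_sum => j _.
by have := sqr_ge0 (u i + v j); rewrite sqrrD; lra.
Qed.

Lemma complete_sum_sqr (f g : 'I_m.+1 -> R) :
  \sum_i \sum_j (f i - g j) ^+ 2 =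
  m.+1%:R * (dispersion f + dispersion g)
  + m.+1%:R ^+ 2 * (mean f - mean g) ^+ 2.
Proof.
rewrite (@biregular_sum_sqr (fun _ _ => true) m.+1) => [|i|i]; rewrite ?card_ord//.
rewrite [X in _ - 2 * X]big1 => [|i _]; last by rewrite -mulr_sumr sum_sub_mean mulr0.
by rewrite mulr0 subr0 natrM expr2.
Qed.

End Blocks.

(** * The quadratic form of the block means on Z / 4 *)

Lemma sum_Z4 (V : nmodType) (f : 'I_4 -> V) :
  \sum_c f c = f 0 + f 1 + f 2 + f 3.
Proof.
rewrite !big_ord_recl big_ord0 addr0 !addrA.
by congr (_ + _ + _ + _); congr f; apply: val_inj.
Qed.

Lemma Z4_E :
  (((0 + 1)%R = 1%R :> 'I_4)
   * ((1 + 1)%R = 2%R :> 'I_4)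
   * ((2 + 1)%R = 3%R :> 'I_4)
   * ((3 + 1)%R = 0%R :> 'I_4)
   * ((0 - 1)%R = 3%R :> 'I_4)
   * ((1 - 1)%R = 0%R :> 'I_4)
   * ((2 - 1)%R = 1%R :> 'I_4)
   * ((3 - 1)%R = 2%R :> 'I_4))%type.
Proof. by do ![split]; apply: val_inj. Qed.

Lemma Z4_elim (P : 'I_4 -> Prop) : P 0 -> P 1 -> P 2 -> P 3 -> forall c, P c.
Proof.
move=> P0 P1 P2 P3 [[|[|[|[|//]]]] lt_c].
- by rewrite (_ : Ordinal _ = 0)//; exact: val_inj.
- by rewrite (_ : Ordinal _ = 1)//; exact: val_inj.
- by rewrite (_ : Ordinal _ = 2)//; exact: val_inj.
- by rewrite (_ : Ordinal _ = 3)//; exact: val_inj.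
Qed.

(** The cosine-weighted edge form on vectors constant on blocks, divided by [2 * cos phi * m ^ 2],
    with m the block size and [t = tan phi]. [P] holds the + values and [N] the - values. The
    thinned links have density [1 - t] and negative cosine; equal signs in consecutive pairs are a
    quarter turn apart and have weight 0. *)
Definition block_form (R : realType) (t : R) (P N : 'I_4 -> R) : R :=
  \sum_c ((P c - N c) ^+ 2 + t * (P c - N (c + 1)) ^+ 2
          - t * (1 - t) * (N c - P (c + 1)) ^+ 2).

(* Found by diagonalizing the shift on [Z / 4]; the threshold [t = 1 / 2] is
   where the modes of frequency 1 and 3 lose stability. *)
Lemma block_form_sos (R : realType) (t : R) (P N : 'I_4 -> R) :
  (1 + t ^+ 2) * block_form t P N =
  \sum_c ((1 + t ^+ 2) * P c - N c - t * N (c + 1)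
          + t * (1 - t) * N (c - 1)) ^+ 2
  + t ^+ 2 * (N 0 - N 1 + N 2 - N 3) ^+ 2
  + t ^+ 2 * (2 * t - 1) * ((N 0 - N 2) ^+ 2 + (N 1 - N 3) ^+ 2).
Proof.
rewrite /block_form !sum_Z4.
by rewrite !Z4_E; ring.
Qed.

(** In the sum of squares, the alternating sum and the two differences [N 0 - N 2], [N 1 - N 3]
    control all differences of [N]; the linear forms [l c] then tie each [P c] to [N c]. *)
Lemma block_form_coercive (R : realType) (t : R) :
  1 / 2 < t -> t <= 1 ->
  exists2 K : R, 0 < K & forall (Y : 'I_4 -> bool -> R) c s c' s',
    (Y c s - Y c' s') ^+ 2 <= K * block_form t (Y^~ true) (Y^~ false).
Proof.
move=> t2 t1; have d0 : 0 < 2 * t - 1 by lra.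
(* The factor [8 / (2 * t - 1)] comes from [t ^+ 2 >= 1 / 4] and [1 + t ^+ 2 <= 2]; 10 rounds up
   [4 + 3 / 2 + 4], the path through [P], [N], [N], [P]. *)
exists (10 ^+ 2 * (8 / (2 * t - 1))).
  by rewrite mulr_gt0 ?exprn_gt0 ?divr_gt0.
move=> Y c s c' s'; set F := block_form _ _ _.
pose P c := Y c true; pose N c := Y c false.
have := block_form_sos t P N; rewrite -/F.
pose l c := (1 + t ^+ 2) * P c - N c - t * N (c + 1) + t * (1 - t) * N (c - 1).
rewrite -/(\sum_c l c ^+ 2) => sos.
have L0 : 0 <= \sum_c l c ^+ 2 by apply: sumr_ge0 => k _; exact: sqr_ge0.
have lL k : l k ^+ 2 <= \sum_c l c ^+ 2.
  by rewrite (bigD1 k)//= lerDl sumr_ge0// => i _; exact: sqr_ge0.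
set alt := N 0 - _ + _ - _ in sos.
have alt0 := sqr_ge0 alt; have e0 := sqr_ge0 (N 0 - N 2); have o0 := sqr_ge0 (N 1 - N 3).
have A0 : 0 <= t ^+ 2 * alt ^+ 2 by rewrite mulr_ge0 ?sqr_ge0.
have D0 : 0 <= t ^+ 2 * (2 * t - 1) * ((N 0 - N 2) ^+ 2 + (N 1 - N 3) ^+ 2).
  by apply: mulr_ge0; [apply: mulr_ge0; [exact: sqr_ge0|lra]|exact: addr_ge0].
have F0 : 0 <= F.
  by rewrite -(@pmulr_rge0 _ (1 + t ^+ 2)) ?sos; [lra|nra].
pose B := 8 / (2 * t - 1) * F.
pose b := Num.sqrt B.
have B0 : 0 <= B by rewrite mulr_ge0// divr_ge0// ltW.
have Bd : B * (2 * t - 1) = 8 * F by rewrite /B mulrAC divfK ?gt_eqF.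
have b0 : 0 <= b by exact: sqrtr_ge0.
have bB x : x ^+ 2 <= B -> `|x| <= b.
  by move=> xB; rewrite -sqrtr_sqr ler_wsqrtr.
have F2 : (1 + t ^+ 2) * F <= 2 * F by rewrite ler_wpM2r//; nra.
have t4 : 1 / 4 <= t ^+ 2 by nra.
have td : (2 * t - 1) / 4 <= t ^+ 2 * (2 * t - 1) by nra.
have BF : 8 * F <= B by rewrite -Bd ler_piMr//; lra.
have lb k : `|l k| <= b.
  apply: bB; apply: le_trans (lL k) _.
  lra.
have altb : `|alt| <= b.
  apply: bB.
  have : 1 / 4 * alt ^+ 2 <= t ^+ 2 * alt ^+ 2 by rewrite ler_wpM2r.
  lra.
have eo : (N 0 - N 2) ^+ 2 + (N 1 - N 3) ^+ 2 <= B.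
  rewrite -(ler_pM2r d0) Bd.
  have : (2 * t - 1) / 4 * ((N 0 - N 2) ^+ 2 + (N 1 - N 3) ^+ 2) <=
    t ^+ 2 * (2 * t - 1) * ((N 0 - N 2) ^+ 2 + (N 1 - N 3) ^+ 2).
    by rewrite ler_wpM2r// addr_ge0.
  lra.
have eb : `|N 0 - N 2| <= b by apply: bB; lra.
have ob : `|N 1 - N 3| <= b by apply: bB; lra.
have Nb : forall k k', `|N k - N k'| <= 3 / 2 * b.
  clear -altb eb ob b0.
  move: altb eb ob; rewrite /alt !ler_norml => /andP[? ?] /andP[? ?] /andP[? ?].
  by apply: Z4_elim; apply: Z4_elim; rewrite ler_norml; lra.
have Pb k : `|P k - N k| <= 4 * b.
  have : (1 + t ^+ 2) * (P k - N k) =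
      l k + t * (N (k + 1) - N k) - t * (1 - t) * (N (k - 1) - N k).
    by rewrite /l; ring.
  have := lb k; have := Nb (k + 1) k; have := Nb (k - 1) k.
  rewrite !ler_norml.
  move: (l k) (N (k + 1) - N k) (N (k - 1) - N k) (P k - N k) => x y z w.
  clear -t2 t1 b0.
  move=> /andP[z1 z2] /andP[y1 y2] /andP[x1 x2] E.
  have ty1 : t * y <= 3 / 2 * b by nra.
  have ty2 : - (3 / 2 * b) <= t * y by nra.
  have tt0 : 0 <= t * (1 - t) by nra.
  have tt1 : t * (1 - t) <= 1 by nra.
  have tz1 : t * (1 - t) * z <= 3 / 2 * b by nra.
  have tz2 : - (3 / 2 * b) <= t * (1 - t) * z by nra.
  have tw : `|(1 + t ^+ 2) * w| <= 4 * b by rewrite E ler_norml; lra.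
  rewrite -ler_norml; apply: le_trans tw; rewrite normrM ler_peMl//.
  by rewrite ger0_norm; nra.
have Yb : `|Y c s - Y c' s'| <= 10 * b.
  have Ys k x : `|Y k x - N k| <= 4 * b.
    by case: x; [exact: Pb|rewrite subrr normr0; lra].
  have := Nb c c'; have := Ys c s; have := Ys c' s'.
  by rewrite !ler_norml; lra.
rewrite -real_normK ?num_real//; apply: le_trans (_ : (10 * b) ^+ 2 <= _).
  by rewrite lerXn2r// nnegrE mulr_ge0.
by rewrite exprMn sqr_sqrtr// /B [leLHS]mulrA lexx.
Qed.

(** The equation [M * S = (p + 1) * C] is the equilibrium condition; it turns the terms in the means
    into a multiple of [block_form]. The dispersions keep a positive coefficient because the doubled
    loss [2 * p] on thinned links is still below [M]. *)
Lemma block_sum_ge (R : realType) (M p C S : R) (w y : 'I_4 -> bool -> R)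
    (full part : 'I_4 -> bool -> 'I_4 -> bool -> R) :
  M = 2 * p + 1 -> 0 <= p -> 0 < C -> 0 < S -> M * S = (p + 1) * C ->
  (forall c s, 0 <= w c s) ->
  (forall c s c' s', full c s c' s' =
     M * (w c s + w c' s') + M ^+ 2 * (y c s - y c' s') ^+ 2) ->
  (forall c s c' s', part c s c' s' =
     2 * p * (w c s + w c' s') + p * M * (y c s - y c' s') ^+ 2) ->
  2 * (\sum_c \sum_s w c s)
  + 2 * C * block_form ((p + 1) / M) (y^~ true) (y^~ false) <=
  \sum_c ((full c true c true + C * full c true c false
     + S * full c true (c + 1) false - S * part c true (c - 1) false)
   + (full c false c false + C * full c false c true
     - S * part c false (c + 1) true + S * full c false (c - 1) true)).
Proof.
move=> Mp p0 C0 S0 MS w0 fullE partE; set t := (p + 1) / M.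
pose F := block_form t (y^~ true) (y^~ false).
have M1 : 1 <= M by lra.
have M0 : 0 < M by lra.
have tM : t * M = p + 1 by rewrite divfK// gt_eqF.
have SE : S = C * t by rewrite /t mulrA [C * _]mulrC -MS mulrC mulKf// gt_eqF.
have pE : p = (1 - t) * M by rewrite mulrBl tM; lra.
have t2 : 1 / 2 < t by rewrite ltr_pdivlMr//; lra.
have t1 : t <= 1 by rewrite ler_pdivrMr//; lra.
have F0 : 0 <= F.
  have [K K0 /(_ y 0 true 0 true)] := block_form_coercive t2 t1.
  by rewrite subrr expr0n pmulr_rge0.
rewrite [leRHS](_ : _ =
    (2 * M + 2 * C * M + 2 * S * M - 4 * S * p) * (\sum_c \sum_s w c s)
    + 2 * C * M ^+ 2 * F); last first.
  under [in RHS]eq_bigr do rewrite big_bool.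
  rewrite /F /block_form !sum_Z4 !fullE !partE.
  by rewrite !Z4_E /= SE pE; ring.
have W0 : 0 <= \sum_c \sum_s w c s.
  by apply: sumr_ge0 => c _; apply: sumr_ge0 => s _.
have CM0 : 0 <= C * M by rewrite mulr_ge0 ?ltW.
have SM0 : 0 <= S * (M - 2 * p) by rewrite mulr_ge0 ?ltW//; lra.
apply: lerD; rewrite ler_wpM2r//; first by clear -M1 CM0 SM0; lra.
by rewrite ler_peMr ?exprn_ege1// mulr_ge0// ltW.
Qed.

(** * The graph and its equilibrium *)

Section Graph.
Variable r : nat.

Definition vertex : finType := ('I_4 * bool * 'I_r.*2.+1)%type.

(** The sum is taken modulo 2r + 1, so each index has r partners; a sum rather than a difference
    makes the relation symmetric. *)
Definition linked (i j : 'I_r.*2.+1) : bool := ((i + j)%R < r)%N.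

(** [true] stands for + and [false] for -; only the links from (c, -) to (c + 1, +) are thinned. *)
Definition forward (a b : vertex) : bool :=
  (b.1.1 == a.1.1 + 1) && [|| a.1.2, ~~ b.1.2 | linked a.2 b.2].

Definition adj (a b : vertex) : bool :=
  [|| (a.1.1 == b.1.1) && (a != b), forward a b | forward b a].

Lemma linkedC : symmetric linked.
Proof. by move=> i j; rewrite /linked addrC. Qed.

Lemma card_linked i : #|[pred j | linked i j]| = r.
Proof.
have lt_r : (r <= r.*2.+1)%N by lia.
rewrite -sum1_card (reindex (fun j => j - i))/=; last first.
  by exists (fun j => j + i) => j _; rewrite ?subrK ?addrK.
under eq_bigl => j do rewrite inE /linked addrC subrK.
by rewrite -(big_ord_widen _ (fun _ => 1%N) lt_r) sum1_card card_ord.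
Qed.

Lemma adj_sym : symmetric adj.
Proof.
by move=> a b; rewrite /adj (eq_sym a.1.1) (eq_sym a) [forward a b || _]orbC.
Qed.

Lemma adj_irrefl : irreflexive adj.
Proof.
move=> a; rewrite /adj /forward !eqxx/= orbb.
by rewrite -[X in X == _]addr0 (inj_eq (addrI _)).
Qed.

Lemma sum_vertex (V : nmodType) (F : vertex -> V) :
  \sum_a F a = \sum_c \sum_s \sum_i F (c, s, i).
Proof.
rewrite [RHS]pair_bigA/= [RHS]pair_bigA/=.
by apply: eq_bigr => -[[c s] i].
Qed.

(** Degrees, forces and the cosine-weighted form are all read off this split of a neighbourhood by
    pair offset and sign. *)
Lemma sum_adj (V : nmodType) (F : vertex -> V) c s i :
  \sum_(b | adj (c, s, i) b) F b =
  \sum_(j | j != i) F (c, s, j) + \sum_j F (c, ~~ s, j)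
  + \sum_j F (c + 1, s, j) + \sum_(j | s || linked i j) F (c + 1, ~~ s, j)
  + \sum_j F (c - 1, s, j) + \sum_(j | ~~ s || linked i j) F (c - 1, ~~ s, j).
Proof.
have c_eq (d d' : 'I_4) : (c + d == c + d') = (d == d').
  by rewrite (inj_eq (addrI _)).
rewrite big_mkcond sum_vertex (reindex (fun d => c + d))/=; last first.
  by exists (fun d => d - c) => d _; [rewrite addrAC subrr add0r|rewrite addrC subrK].
have row (d : 'I_4) s' : \sum_j (if adj (c, s, i) (c + d, s', j)
     then F (c + d, s', j) else 0) =
   \sum_(j | [|| (d == 0) && ((s, i) != (s', j)),
       (d == 1) && [|| s, ~~ s' | linked i j]
     | (d == - 1) && [|| s', ~~ s | linked i j]]) F (c + d, s', j).
  rewrite -big_mkcond; apply: eq_bigl => j.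
  rewrite /adj /forward/= c_eq linkedC -addrA -[X in X == c + (d + 1)]addr0 c_eq.
  rewrite -[X in X == c + d]addr0 c_eq eq_sym.
  rewrite [0 == d + 1]eq_sym addr_eq0.
  rewrite !xpair_eqE -[X in X == c + d]addr0 c_eq [0 == d]eq_sym.
  by case: eqP => [->|].
under eq_bigr do under eq_bigr do rewrite row.
have diag (b : bool) (G : 'I_r.*2.+1 -> V) :
    \sum_(j | ((b, i) != (b, j)) || false) G j = \sum_(j | j != i) G j.
  by apply: eq_bigl => j; rewrite orbF xpair_eqE eqxx eq_sym.
have half (G : 'I_r.*2.+1 -> V) :
    \sum_(j | linked i j || false) G j = \sum_(j | linked i j) G j.
  by apply: eq_bigl => j; rewrite orbF.
have -> : - 1 = 3 :> 'I_4 by exact: val_inj.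
rewrite sum_Z4 !big_bool addr0.
case: s row => _ /=; rewrite diag ?half !big_pred0_eq !addr0 !addrA//.
rewrite [X in X + _ + _ + _ + _ = _]addrC -!addrA; congr (_ + (_ + _)).
by rewrite addrCA; congr (_ + (_ + _)); exact: addrC.
Qed.

(** * The equilibrium and its stability *)

Section Angles.
Variables (R : realType) (phi eta : R).

(** [eta] is a global rotation, chosen later to place every angle strictly between 0 and
    [2 * pi]. *)
Definition angle (a : vertex) : R := a.1.1%:R * (pi / 2) + a.1.2%:R * phi + eta.

(** Phrased through cosine and sine because from pair 3 to pair 0 the angle advances by a quarter
    turn only modulo [2 * pi]. *)
Lemma cos_sin_angle_next c s i j :
  cos (angle (c + 1, s, i)) = - sin (angle (c, s, j)) /\
  sin (angle (c + 1, s, i)) = cos (angle (c, s, j)).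
Proof.
have turn x : cos (x + pi / 2) = - sin x /\ sin (x + pi / 2) = cos x.
  by rewrite cosDpihalf sinDpihalf.
pose k (c : 'I_4) : R := (nat_of_ord c)%:R.
have angleE c0 s0 i0 : angle (c0, s0, i0) = k c0 * (pi / 2) + s0%:R * phi + eta by [].
have k0 : k 0 = 0 by [].
have k1 : k 1 = 1 by [].
have k2 : k 2 = 2 by [].
have k3 : k 3 = 3 by [].
elim/Z4_elim: c.
- have -> : angle (0 + 1, s, i) = angle (0, s, j) + pi / 2.
    by rewrite !angleE Z4_E k0 k1; ring.
  exact: turn.
- have -> : angle (1 + 1, s, i) = angle (1, s, j) + pi / 2.
    by rewrite !angleE Z4_E k1 k2; ring.
  exact: turn.
- have -> : angle (2 + 1, s, i) = angle (2, s, j) + pi / 2.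
    by rewrite !angleE Z4_E k2 k3; ring.
  exact: turn.
- rewrite -cosD2pi -[X in _ /\ X = _]sinD2pi.
  have -> : angle (3 + 1, s, i) + pi *+ 2 = angle (3, s, j) + pi / 2.
    by rewrite !angleE Z4_E k3 k0 mulr2n; field.
  exact: turn.
Qed.

Lemma angle_diff c s s' i j :
  angle (c, s, i) - angle (c, s', j) = (s%:R - s'%:R) * phi.
Proof. by rewrite /angle/=; ring. Qed.

Lemma cos_angle_next c s s' i j :
  cos (angle (c, s, i) - angle (c + 1, s', j)) = sin ((s%:R - s'%:R) * phi).
Proof.
have [E F] := cos_sin_angle_next c s' j j.
by rewrite -(angle_diff c s s' i j) cosB sinB E F; ring.
Qed.

Lemma cos_angle_prev c s s' i j :
  cos (angle (c, s, i) - angle (c - 1, s', j)) = sin ((s'%:R - s%:R) * phi).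
Proof.
by rewrite -cosN opprB -{2}(subrK 1 c) cos_angle_next.
Qed.

Lemma sin_angle_next c s s' i j :
  sin (angle (c + 1, s', j) - angle (c, s, i)) = cos ((s'%:R - s%:R) * phi).
Proof.
have [E F] := cos_sin_angle_next c s' j j.
by rewrite -(angle_diff c s' s j i) cosB sinB E F; ring.
Qed.

Lemma sin_angle_prev c s s' i j :
  sin (angle (c - 1, s', j) - angle (c, s, i)) = - cos ((s%:R - s'%:R) * phi).
Proof.
by rewrite -opprB sinN -{1}(subrK 1 c) sin_angle_next.
Qed.

Hypothesis phi_tan : r.*2.+1%:R * sin phi = r.+1%:R * cos phi.

(** Equal-sign blocks of the next and previous pairs cancel. The partner block pulls with (2r + 1)
    sin phi, against cos phi times 2r + 1 full minus r thinned links; [phi_tan] balances them. *)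
Lemma angle_equilibrium a : \sum_(b | adj a b) sin (angle b - angle a) = 0.
Proof.
case: a => [[c s] i]; rewrite sum_adj.
under eq_bigr do rewrite angle_diff subrr mul0r sin0.
under [X in _ + X + _ + _ + _ + _]eq_bigr do rewrite angle_diff.
under [X in _ + _ + X + _ + _ + _]eq_bigr do rewrite sin_angle_next subrr mul0r cos0.
under [X in _ + _ + _ + X + _ + _]eq_bigr do rewrite sin_angle_next.
under [X in _ + _ + _ + _ + X + _]eq_bigr do rewrite sin_angle_prev subrr mul0r cos0.
under [X in _ + _ + _ + _ + _ + X]eq_bigr do rewrite sin_angle_prev.
have Er : r.*2.+1%:R = 2 * r%:R + 1 :> R by rewrite -natr1 -mul2n natrM.
have phi_tan' : (2 * r%:R + 1) * sin phi = (r%:R + 1) * cos phi.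
  by rewrite -Er natr1.
rewrite !sumr_const card_ord mul0rn add0r !mulNrn.
rewrite -![sin _ *+ _]mulr_natr -![cos _ *+ _]mulr_natr.
case: s => /=; rewrite card_linked card_ord Er;
  rewrite ?sub0r ?subr0 ?mulN1r ?mul1r ?sinN ?cosN; lra.
Qed.

Local Notation t := ((r%:R + 1) / r.*2.+1%:R : R).

Definition block (X : vertex -> R) (c : 'I_4) (s : bool) (i : 'I_r.*2.+1) : R :=
  X (c, s, i).

(** The edge weights are 1 inside a block, [cos phi] inside a pair, [sin phi] on the complete
    opposite-sign links, [- sin phi] on the thinned ones and 0 on equal-sign links between pairs. *)
Lemma angle_form_ge (X : vertex -> R) :
  0 < sin phi -> 0 < cos phi ->
  2 * (\sum_c \sum_s dispersion (block X c s))
  + 2 * cos phi * block_form t (fun c => mean (block X c true))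
                             (fun c => mean (block X c false)) <=
  \sum_a \sum_(b | adj a b) cos (angle a - angle b) * (X a - X b) ^+ 2.
Proof.
move=> S0 C0; pose Y := block X; set S := sin phi in S0 *; set C := cos phi in C0 *.
pose full (f g : 'I_r.*2.+1 -> R) := \sum_i \sum_j (f i - g j) ^+ 2.
pose part (f g : 'I_r.*2.+1 -> R) := \sum_i \sum_(j | linked i j) (f i - g j) ^+ 2.
have -> : \sum_a \sum_(b | adj a b) cos (angle a - angle b) * (X a - X b) ^+ 2 =
    \sum_c ((full (Y c true) (Y c true) + C * full (Y c true) (Y c false)
             + S * full (Y c true) (Y (c + 1) false) - S * part (Y c true) (Y (c - 1) false))
          + (full (Y c false) (Y c false) + C * full (Y c false) (Y c true)
             - S * part (Y c false) (Y (c + 1) true) + S * full (Y c false) (Y (c - 1) true))).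
  rewrite sum_vertex; apply: eq_bigr => c _.
  have own s : \sum_i \sum_(j | j != i) cos (angle (c, s, i) - angle (c, s, j)) *
      (X (c, s, i) - X (c, s, j)) ^+ 2 = full (Y c s) (Y c s).
    rewrite /full; apply: eq_bigr => i _; rewrite (bigD1 (F := fun j => (_ - _ j) ^+ 2) i)//=.
    rewrite (subrr (Y c s i)) expr0n/= add0r.
    by apply: eq_bigr => j _; rewrite angle_diff subrr mul0r cos0 mul1r.
  have scal (A : rel 'I_r.*2.+1) s c' s' k :
      (forall i j, cos (angle (c, s, i) - angle (c', s', j)) = k) ->
      \sum_i \sum_(j | A i j) cos (angle (c, s, i) - angle (c', s', j)) *
        (X (c, s, i) - X (c', s', j)) ^+ 2 =
      k * \sum_i \sum_(j | A i j) (Y c s i - Y c' s' j) ^+ 2.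
    move=> cosk; rewrite mulr_sumr; apply: eq_bigr => i _; rewrite mulr_sumr.
    by apply: eq_bigr => j _; rewrite cosk.
  rewrite big_bool/=; congr (_ + _); under eq_bigr do rewrite sum_adj/=;
    rewrite !big_split/= own.
    rewrite (@scal (fun _ _ => true) _ _ _ C) => [|i j]; last first.
      by rewrite angle_diff subr0 mul1r.
    rewrite (@scal (fun _ _ => true) _ _ _ 0) => [|i j]; last first.
      by rewrite cos_angle_next subrr mul0r sin0.
    rewrite (@scal (fun _ _ => true) _ _ _ S) => [|i j]; last first.
      by rewrite cos_angle_next subr0 mul1r.
    rewrite (@scal (fun _ _ => true) _ _ _ 0) => [|i j]; last first.
      by rewrite cos_angle_prev subrr mul0r sin0.
    rewrite (@scal linked _ _ _ (- S)) => [|i j]; last first.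
      by rewrite cos_angle_prev sub0r mulN1r sinN.
    by rewrite !mul0r !addr0 mulNr.
  rewrite (@scal (fun _ _ => true) _ _ _ C) => [|i j]; last first.
    by rewrite angle_diff sub0r mulN1r cosN.
  rewrite (@scal (fun _ _ => true) _ _ _ 0) => [|i j]; last first.
    by rewrite cos_angle_next subrr mul0r sin0.
  rewrite (@scal linked _ _ _ (- S)) => [|i j]; last first.
    by rewrite cos_angle_next sub0r mulN1r sinN.
  rewrite (@scal (fun _ _ => true) _ _ _ 0) => [|i j]; last first.
    by rewrite cos_angle_prev subrr mul0r sin0.
  rewrite (@scal (fun _ _ => true) _ _ _ S) => [|i j]; last first.
    by rewrite cos_angle_prev subr0 mul1r.
  by rewrite !mul0r !addr0 mulNr.
have partC (f g : 'I_r.*2.+1 -> R) : part f g <=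
    2 * r%:R * (dispersion f + dispersion g)
    + r%:R * r.*2.+1%:R * (mean f - mean g) ^+ 2.
  rewrite -[r%:R * r.*2.+1%:R]natrM; apply: biregular_sum_sqr_le => i; first exact: card_linked.
  by rewrite -[RHS](card_linked i); apply: eq_card => j; rewrite !inE linkedC.
pose M : R := r.*2.+1%:R; pose p : R := r%:R.
pose w c s := dispersion (Y c s); pose y c s := mean (Y c s).
(* [fulls] gives the exact value of a complete block sum, [parts] only the upper bound for a thinned
   one. *)
pose fulls c s c' s' := M * (w c s + w c' s') + M ^+ 2 * (y c s - y c' s') ^+ 2.
pose parts c s c' s' := 2 * p * (w c s + w c' s') + p * M * (y c s - y c' s') ^+ 2.
have fullE c s c' s' : full (Y c s) (Y c' s') = fulls c s c' s'.
  exact: complete_sum_sqr.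
have partE c s c' s' : S * part (Y c s) (Y c' s') <= S * parts c s c' s'.
  by rewrite ler_wpM2l ?(ltW S0)//; exact: partC.
apply: le_trans (@block_sum_ge R M p C S w y fulls parts _ _ C0 S0 _ _ _ _) _ => //.
- by rewrite /M /p -natr1 -mul2n natrM.
- by rewrite phi_tan -natr1.
- by move=> c s; exact: dispersion_ge0.
apply: ler_sum => c _; rewrite !fullE.
by do !apply: lerD => //; rewrite lerN2 partE.
Qed.

Lemma angle_form_coercive :
  0 < sin phi -> 0 < cos phi ->
  exists2 kappa : R, 0 < kappa & forall X : vertex -> R,
    kappa * (\sum_a \sum_b (X a - X b) ^+ 2) <=
    \sum_a \sum_(b | adj a b) cos (angle a - angle b) * (X a - X b) ^+ 2.
Proof.
move=> S0 C0; set C := cos phi in C0.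
have r0 : 0 <= r%:R :> R by [].
have M2 : r.*2.+1%:R = 2 * r%:R + 1 :> R by rewrite -natr1 -mul2n natrM.
have M0 : 0 < r.*2.+1%:R :> R by [].
have t2 : 1 / 2 < t by rewrite ltr_pdivlMr// M2; lra.
have t1 : t <= 1 by rewrite ler_pdivrMr// M2; lra.
have [K K0 coer] := block_form_coercive t2 t1.
pose n : R := #|{: vertex}|%:R.
have n0 : 0 < n by rewrite ltr0n; apply/card_gt0P; exists (0, true, 0).
(* Each [X a - X b] passes through two block means: the factor 3 splits the square, the end pieces
   cost [2 * W <= Q] and the middle one [K * F <= K / (2 * C) * Q]. *)
pose L := 3 * (1 + K / (2 * C)).
have L0 : 0 < L by rewrite mulr_gt0// addr_gt0// divr_gt0// mulr_gt0.
exists (n ^+ 2 * L)^-1 => [|X]; first by rewrite invr_gt0 mulr_gt0// exprn_gt0.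
set Q := leRHS; pose W := \sum_c \sum_s dispersion (block X c s).
pose y c s := mean (block X c s).
set F := block_form t (y^~ true) (y^~ false).
have WFQ : 2 * W + 2 * C * F <= Q by exact: angle_form_ge.
have F0 : 0 <= F.
  have := coer y 0 true 0 true.
  by rewrite subrr expr0n pmulr_rge0.
have dW a : (X a - y a.1.1 a.1.2) ^+ 2 <= W.
  case: a => [[c s] i] /=; apply: (@le_trans _ _ (dispersion (block X c s))).
    rewrite /dispersion (bigD1 i)//= lerDl.
    by apply: sumr_ge0 => j _; exact: sqr_ge0.
  rewrite /W (bigD1 c)//= (bigD1 s)//= -addrA lerDl.
  apply: addr_ge0; last apply: sumr_ge0 => c' _.
    by apply: sumr_ge0 => s' _; exact: dispersion_ge0.
  by apply: sumr_ge0 => s' _; exact: dispersion_ge0.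
have W0 : 0 <= W by apply: le_trans (dW (0, true, 0)); exact: sqr_ge0.
have Q0 : 0 <= Q by apply: le_trans WFQ; rewrite addr_ge0// mulr_ge0// mulr_ge0// ltW.
have KF : K * F <= K / (2 * C) * Q.
  rewrite -mulrA ler_wpM2l ?(ltW K0)// ler_pdivlMl ?mulr_gt0//; lra.
have pair a b : (X a - X b) ^+ 2 <= L * Q.
  have := dW a; have := dW b; have := coer y a.1.1 a.1.2 b.1.1 b.1.2; rewrite -/F.
  move: (y a.1.1 a.1.2) (y b.1.1 b.1.2) (X a) (X b) => p q x z pq zq xp.
  have CF : 0 <= 2 * C * F by rewrite mulr_ge0// mulr_ge0// ltW.
  have : (x - z) ^+ 2 <= 3 * ((x - p) ^+ 2 + (p - q) ^+ 2 + (z - q) ^+ 2).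
    have := sqr_ge0 (x - p - (p - q)); have := sqr_ge0 (p - q - (q - z)).
    have := sqr_ge0 (x - p - (q - z)).
    by clear; lra.
  rewrite /L -mulrA mulrDl mul1r.
  lra.
have nL0 : 0 < n ^+ 2 * L by rewrite mulr_gt0 ?exprn_gt0.
rewrite ler_pdivrMl//.
apply: (@le_trans _ _ (\sum_(a : vertex) \sum_(b : vertex) L * Q)).
  by apply: ler_sum => a _; apply: ler_sum => b _.
by rewrite !sumr_const -[leLHS]mulr_natl -[L * Q *+ _]mulr_natl expr2 !mulrA.
Qed.

End Angles.

(** There are 2r neighbours in the own block, four complete blocks of 2r + 1, and r thinned
    links. *)
Lemma degree_adj (a : vertex) : #|[pred b | adj a b]| = (11 * r + 4)%N.
Proof.
case: a => [[c s] i].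
have := @sum_adj nat (fun=> 1%N) c s i; rewrite !sum1_card !card_ord => E.
have {}E : #|[pred b | adj (c, s, i) b]| =
  (#|[pred j | j != i]| + r.*2.+1 + r.*2.+1 + #|[pred j | s || linked i j]|
   + r.*2.+1 + #|[pred j | ~~ s || linked i j]|)%N by exact: E.
rewrite E.
have -> : #|[pred j | j != i]| = r.*2 by rewrite cardC1 card_ord.
by case: s {E} => /=; rewrite card_linked card_ord; lia.
Qed.

Lemma card_vertex : #|{: vertex}| = (16 * r + 8)%N.
Proof. by rewrite !card_prod !card_ord card_bool; lia. Qed.

End Graph.

(** * Numbering the vertices, and failure of synchronization *)

Lemma sum_enum_val (T : finType) (V : nmodType) (P : pred T) (F : T -> V) :
  \sum_(u < #|{: T}| | P (enum_val u)) F (enum_val u) = \sum_(a | P a) F a.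
Proof. by rewrite [RHS](reindex _ (onW_bij _ (@enum_val_bij T))). Qed.

Definition graph (r : nat) : rel 'I_#|{: vertex r}| :=
  fun u v => adj (enum_val u) (enum_val v).

Lemma graph_simple r : simple_graph (@graph r).
Proof.
by split=> [u v|u]; rewrite /graph; [exact: adj_sym|exact: adj_irrefl].
Qed.

Lemma graph_min_degree r : (11 * r + 4 <= min_degree (@graph r))%N.
Proof.
rewrite /min_degree; elim/big_ind: _ => [|d d' ? ?|u _].
(* The default value of [min_degree] is the number of vertices, 16r + 8. *)
- by rewrite card_vertex; lia.
- by rewrite leq_min; apply/andP.
- rewrite /degree -(degree_adj (enum_val u)) -!sum1_card.
  rewrite -(sum_enum_val (adj (enum_val u)) (fun=> 1%N)).
  by apply: eq_leq; apply: eq_bigl => v; rewrite inE.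
Qed.

Lemma graph_not_synchronizes (R : realType) r : ~ synchronizes R (@graph r).
Proof.
pose t : R := r.+1%:R / r.*2.+1%:R; pose phi : R := atan t.
(* The unrotated angles fill [[0, 3 * pi / 2 + phi]]; half of the remaining gap goes to each
   side. *)
pose eta : R := (pi / 2 - phi) / 2.
have phi_lt : phi < pi / 2 by exact: atan_ltpi2.
have t0 : 0 < t by rewrite divr_gt0.
have C0 : 0 < cos phi by apply: cos_gt0_pihalf; rewrite atan_gtNpi2 atan_ltpi2.
have SC : sin phi = t * cos phi.
  by rewrite -[t]atanK /tan divfK// gt_eqF.
have S0 : 0 < sin phi by rewrite SC mulr_gt0.
have phi0 : 0 < phi.
  rewrite ltNge; apply/negP => phi_le; suff : 0 <= sin (- phi).
    by rewrite sinN; lra.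
  by apply: sin_ge0_pi; have := atan_gtNpi2 t; have := pi_gt0 R; rewrite -/phi; lra.
have phi_tan : r.*2.+1%:R * sin phi = r.+1%:R * cos phi.
  by rewrite SC /t mulrA mulrCA divff ?mulr1.
have [kappa kappa0 coer] := angle_form_coercive eta phi_tan S0 C0.
pose theta (u : 'I_#|{: vertex r}|) := angle phi eta (enum_val u).
pose u0 : 'I_#|{: vertex r}| := enum_rank ((1, true, 0) : vertex r).
pose v0 : 'I_#|{: vertex r}| := enum_rank ((0, true, 0) : vertex r).
apply: (@stable_not_synchronizes R _ (@graph r) (graph_simple r).1 theta kappa
  _ kappa0 _ u0 v0).
- move=> v; rewrite (sum_enum_val (adj (enum_val v))
    (fun b => sin (angle phi eta b - angle phi eta (enum_val v)))).
  exact: angle_equilibrium.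
- move=> x; pose X a := x (enum_rank a : 'I_#|{: vertex r}|).
  have XE u : X (enum_val u) = x u by rewrite /X enum_valK.
  have -> : spread x = \sum_a \sum_b (X a - X b) ^+ 2.
    rewrite /spread -[RHS](sum_enum_val xpredT); apply: eq_bigr => u _.
    by rewrite -[RHS](sum_enum_val xpredT); apply: eq_bigr => v _; rewrite !XE.
  apply: le_trans (coer X) _; rewrite -[leLHS](sum_enum_val xpredT).
  apply: ler_sum => u _; rewrite -[leLHS]sum_enum_val.
  by apply: ler_sum => v _; rewrite !XE.
- move=> v; rewrite /theta /angle; case: (enum_val v) => [[c s] i] /=.
  have c3 : c%:R <= 3 :> R by rewrite ler_nat -ltnS.
  have c0 : 0 <= c%:R :> R by [].
  have pi0 := pi_gt0 R.
  have cpi : c%:R * (pi / 2) <= 3 * (pi / 2) :> R by rewrite ler_wpM2r//; lra.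
  have cpi0 : 0 <= c%:R * (pi / 2) :> R by rewrite mulr_ge0//; lra.
  have s0 : 0 <= s%:R * phi by rewrite mulr_ge0// ltW.
  have s1 : s%:R * phi <= phi by rewrite ler_piMl ?(ltW phi0)// lern1 leq_b1.
  apply/andP; rewrite /eta; split; first by lra.
  apply: (@le_lt_trans _ _ (3 * (pi / 2) + phi + (pi / 2 - phi) / 2)); last by lra.
  by rewrite lerD2r lerD.
- rewrite /theta /u0 /v0 !enum_rankK /angle.
  rewrite -[LHS]/(1%:R * (pi / 2) + 1%:R * phi + eta
                  - (0%:R * (pi / 2) + 1%:R * phi + eta)).
  by ring.
Qed.

(** * Density 11/16 in the limit *)

Lemma dense_not_synchronizing (R : realType) (mu : R) :
  mu < 11 / 16 ->
  exists (n : nat) (e : rel 'I_n),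
    [/\ (1 < n)%N, simple_graph e,
        mu * n.-1%:R <= (min_degree e)%:R & ~ synchronizes R e].
Proof.
(* The inequality [mu * (16 * r + 7) <= 11 * r + 4] amounts to [77 / 16 - 4 = 13 / 16 <= (11 / 16 -
   mu) * (16 * r + 7)]. *)
move=> mu_lt; pose r := Num.bound (13 / 16 / (11 / 16 - mu)).
have gap0 : 0 < 11 / 16 - mu by lra.
have r_ge : 13 / 16 <= (11 / 16 - mu) * r%:R.
  rewrite -ler_pdivrMl// mulrC; apply/ltW/archi_boundP.
  by rewrite divr_ge0// ltW.
exists #|{: vertex r}|, (@graph r); split.
- by rewrite card_vertex; lia.
- exact: graph_simple.
- apply: (@le_trans _ _ (11 * r + 4)%:R); last by rewrite ler_nat graph_min_degree.
  rewrite card_vertex (_ : (16 * r + 8).-1 = 16 * r + 7)%N; last by lia.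
  rewrite !natrD !natrM; nra.
- exact: graph_not_synchronizes.
Qed.

Lemma min_degree_lt (n : nat) (e : rel 'I_n) :
  (0 < n)%N -> irreflexive e -> (min_degree e <= n.-1)%N.
Proof.
case: n e => // n e _ e_irr; rewrite /min_degree big_ord_recl geq_min; apply/orP; left.
rewrite /degree -ltnS -[X in (_ < X)%N]card_ord -cardsT proper_card//.
rewrite properT; apply/eqP => /setP/(_ ord0).
by rewrite !inE e_irr.
Qed.

(** Vacuous, as no strong density exceeds 1; it makes the set of thresholds nonempty, so that its
    infimum is meaningful. *)
Lemma sync_thresholds_1 (R : realType) : sync_thresholds R 1.
Proof.
move=> mu mu1 n e n0 [_ e_irr] dens; exfalso.
have := lt_le_trans mu1 dens; rewrite ltNge => /negP; apply.
rewrite /strong_density; have [->|n1] := posnP n.-1; first by rewrite invr0 mulr0.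
by rewrite ler_pdivrMr ?ltr0n// mul1r ler_nat min_degree_lt.
Qed.

Theorem theorem2 (R : realType) :
  11 / 16 <= critical_connectivity R /\
  (forall mu : R, mu < 11 / 16 ->
     exists (n : nat) (e : rel 'I_n),
       [/\ (0 < n)%N, simple_graph e,
           mu * n.-1%:R <= (min_degree e)%:R &
           ~ synchronizes R e]).
Proof.
split; last first.
  move=> mu /dense_not_synchronizing[n [e [n1 se de ne]]].
  by exists n, e; split=> //; exact: ltnW.
apply: lb_le_inf; first by exists 1; exact: sync_thresholds_1.
move=> m Sm; rewrite leNgt; apply/negP => m_lt.
(* A threshold [m] only speaks of densities above some [mu > m], hence the midpoint. *)
have mid : (m + 11 / 16) / 2 < 11 / 16 by lra.
have [n [e [n1 se de ne]]] := dense_not_synchronizing mid.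
have m_mid : m < (m + 11 / 16) / 2 by lra.
apply/ne/(Sm _ m_mid n e (ltnW n1) se).
rewrite /strong_density ler_pdivlMr; first exact: de.
by rewrite ltr0n -subn1 subn_gt0.
Qed.
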